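(* Let $Y$ and $X$ be locally finite preordered sets, $R$ a $T$-algebra, $K'=I(Y,R)$, $K=I(X,R)$, and suppose that the algebras $K'$ and $K$ satisfy Condition (II). Then: 1. Any isomorphism of algebras $K'\to K$ induces an isomorphism of partially ordered sets $\overline Y\to\overline X$. 2. If Condition (1) or Condition (2) below is satisfied, then every isomorphism $K'\to K$ induces an isomorphism of preordered sets $Y\to X$. Condition (1): for any $x,y\in X$, if $R_x\cong R_y$, then $n_x=n_y$. Condition (2) (the $(n,m)$-condition): for any $n,m\in\mathbb N$, the isomorphism $M(n,R)\cong M(m,R)$ implies $n=m$.
   Context: Rings are associative with nonzero identity; $T$ is a commutative ring and algebras are $T$-algebras. A preordered set (set with a reflexive, transitive relation $\le$) $X$ is locally finite if every interval $\{z:x\le z\le y\}$ is finite. Write $x\sim y$ iff $x\le y$ and $y\le x$; $[x]$ is the $\sim$-class of $x$, and $\overline X=X/\!\sim$ is the induced partially ordered set; an element of $\overline X$ is denoted by any of its representatives. $M(n,R)$ is the ring of $n\times n$ matrices over $R$. $I(X,R)$ is the $T$-algebra of functions $f:X\times X\to R$ with $f(x,y)=0$ if $x\not\le y$, with pointwise addition and $T$-action and product $(fg)(x,y)=\sum_{x\le z\le y}f(x,z)g(z,y)$. For $K=I(X,R)$: $M=\{f\in K:f(x,y)=0\text{ if }x\sim y\}$ (an ideal); $e_x\in K$ is the idempotent with $e_x(t,t)=1$ for $t\in[x]$ and all other values $0$; $R_x=e_xKe_x\cong M(n_x,R)$, where $n_x=|[x]|$ is the order of the matrices in $R_x$. For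 $K'=I(Y,R)$, the ideal and idempotents defined in the same way are denoted $M_1$ and $f_y$ ($y\in Y$). Condition (II) for the algebras $K',K$: for any algebra isomorphism $\varphi:K'\to K$ and every $x\in X$, one has $\varphi^{-1}(e_x)\in f_y+M_1$ for some $y\in Y$. Meaning of ''induces'': the isomorphism $\overline\tau:\overline Y\to\overline X$ induced by $\varphi:K'\to K$ is the one with $\varphi(f_y)\in e_{\overline\tau(y)}+M$ for all $y\in Y$; in part 2, $\overline\tau$ is lifted to an isomorphism of preordered sets $Y\to X$.
   Formalization: Condition (1) is taken for x in X and y in Y (blocks of K compared with blocks of K') instead of x, y in X; as printed, part 2 fails for X a point, Y two equivalent points and R isomorphic to M(2,R). *)

(* Defs.v *)
From HB Require Import structures.
From mathcomp Require Import all_boot all_order all_algebra finmap.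
From mathcomp Require Import generic_quotient.
From mathcomp Require Import boolp classical_sets functions cardinality fsbigop.

Set Implicit Arguments.
Unset Strict Implicit.
Unset Printing Implicit Defensive.

Import Order.TTheory GRing.Theory.

Local Open Scope classical_set_scope.
Local Open Scope quotient_scope.
Local Open Scope ring_scope.

HB.mixin Record isLocallyFinite d X of Order.Preorder d X := {
  finite_interval : forall x y : X, finite_set [set z | (x <= z <= y)%O]
}.

#[short(type="locFinPreorderType")]
HB.structure Definition LocFinPreorder d :=
  {X of Order.Preorder d X & isLocallyFinite d X}.

Section Quotient.
Context {d : Order.disp_t} {X : preorderType d}.

Definition sim (x y : X) : bool := (x <= y)%O && (y <= x)%O.

Lemma sim_refl : reflexive sim.
Proof. by move=> x; rewrite /sim lexx. Qed.

Lemma sim_sym : symmetric sim.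
Proof. by move=> x y; rewrite /sim andbC. Qed.

Lemma sim_trans : transitive sim.
Proof.
move=> y x z /andP[xy yx] /andP[yz zy].
by rewrite /sim (le_trans xy yz) (le_trans zy yx).
Qed.

Canonical sim_equiv := EquivRel sim sim_refl sim_sym sim_trans.

End Quotient.

Section QuotientOrder.
Context {d : Order.disp_t} (X : preorderType d).

Definition pquot : Type := {eq_quot (@sim d X)}.

HB.instance Definition _ := Choice.on pquot.
HB.instance Definition _ := EqQuotient.on pquot.

Definition pquot_le (u v : pquot) : bool := (repr u <= repr v)%O.

Lemma pquot_le_refl : reflexive pquot_le.
Proof. by move=> u; rewrite /pquot_le lexx. Qed.

Lemma pquot_le_anti : antisymmetric pquot_le.
Proof.
move=> u v uv; rewrite -[u]reprK -[v]reprK; exact/eqmodP.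
Qed.

Lemma pquot_le_trans : transitive pquot_le.
Proof. by move=> v u w; exact: le_trans. Qed.

HB.instance Definition _ := Order.Le_isPOrder.Build d pquot
  pquot_le_refl pquot_le_anti pquot_le_trans.

Lemma sim_repr (x : X) : sim (repr (\pi_pquot x)) x.
Proof. by apply/eqmodP; rewrite reprK. Qed.

Lemma pi_le (x y : X) : (\pi_pquot x <= \pi_pquot y)%O = (x <= y)%O.
Proof.
have /andP[rx xr] := sim_repr x; have /andP[ry yr] := sim_repr y.
rewrite [LHS]/(repr (\pi_pquot x) <= repr (\pi_pquot y))%O.
apply/idP/idP => h; first exact: le_trans xr (le_trans h ry).
exact: le_trans rx (le_trans h yr).
Qed.

End QuotientOrder.

Definition order_iso d1 d2 (P : preorderType d1) (Q : preorderType d2)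
    (f : P -> Q) : Prop :=
  bijective f /\ {mono f : x y / (x <= y)%O}.

Section Incidence.
Context {d : Order.disp_t} {T : comNzRingType}.
Variables (X : locFinPreorderType d) (R : algType T).

Definition inc_pred : {pred X -> X -> R} :=
  [pred f | `[< forall x y, ~~ (x <= y)%O -> f x y = 0 >]].

Lemma inc_predP (f : X -> X -> R) :
  reflect (forall x y, ~~ (x <= y)%O -> f x y = 0) (f \in inc_pred).
Proof. exact: asboolP. Qed.

Record incidence := Incidence {
  inc_fun :> X -> X -> R;
  inc_funP : inc_fun \in inc_pred
}.

HB.instance Definition _ := [isSub for inc_fun].
HB.instance Definition _ := [Choice of incidence by <:].

Lemma inc_pred_submod : submod_closed inc_pred.
Proof.
split=> [|t f g /inc_predP f0 /inc_predP g0]; apply/inc_predP => x y xy //.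
by rewrite !fctE f0 // g0 // scaler0 addr0.
Qed.

HB.instance Definition _ := GRing.isSubmodClosed.Build T _ inc_pred
  inc_pred_submod.
HB.instance Definition _ := [SubChoice_isSubLmodule of incidence by <:].

Lemma inc_out (f : incidence) x y : ~~ (x <= y)%O -> f x y = 0.
Proof. by move: x y; apply/inc_predP/inc_funP. Qed.

Lemma incP (f g : incidence) : (forall x y, f x y = g x y) -> f = g.
Proof. by move=> fg; apply/val_inj/funext => x; apply/funext => y. Qed.

Definition inc_one_fun (x y : X) : R := (x == y)%:R.

Lemma inc_one_subproof : inc_one_fun \in inc_pred.
Proof.
apply/inc_predP => x y; rewrite /inc_one_fun; case: eqP => [->|//].
by rewrite lexx.
Qed.

Definition inc_one : incidence := Incidence inc_one_subproof.

Definition inc_mul_fun (f g : incidence) (x y : X) : R :=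
  \sum_(z \in [set z | (x <= z <= y)%O]) f x z * g z y.

Lemma inc_mul_subproof f g : inc_mul_fun f g \in inc_pred.
Proof.
apply/inc_predP => x y xy; rewrite /inc_mul_fun fsbig1 // => z /andP[xz zy].
by rewrite (le_trans xz zy) in xy.
Qed.

Definition inc_mul f g : incidence := Incidence (inc_mul_subproof f g).

Lemma incDE (f g : incidence) x y : (f + g) x y = f x y + g x y.
Proof. by []. Qed.

Let mulE (f g : incidence) x y : inc_mul f g x y =
  \sum_(z <- fset_set [set z | (x <= z <= y)%O]) f x z * g z y.
Proof. by rewrite /= /inc_mul_fun fsbig_finite //; exact: finite_interval. Qed.

Let mem_itv (x y z : X) :
  (z \in fset_set [set z | (x <= z <= y)%O]) = (x <= z <= y)%O.
Proof.
by rewrite in_fset_set ?inE //; [apply/idP/idP; rewrite inE | exact: finite_interval].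
Qed.

Let mulE_widen (f g : incidence) x y a b : (a <= x)%O -> (y <= b)%O ->
  inc_mul f g x y =
  \sum_(z <- fset_set [set z | (a <= z <= b)%O]) f x z * g z y.
Proof.
move=> ax yb; rewrite -fsbig_finite; last exact: finite_interval.
apply: fsbig_widen => [z /andP[xz zy]|z [_ /negP]].
  by rewrite /= (le_trans ax xz) (le_trans zy yb).
rewrite negb_and => /orP[xz|zy] /=.
  by rewrite inc_out // mul0r.
by rewrite (inc_out g) // mulr0.
Qed.

Lemma inc_mulA : associative inc_mul.
Proof.
move=> f g h; apply: incP => x y; rewrite !mulE.
transitivity (\sum_(z <- fset_set [set z | (x <= z <= y)%O])
  \sum_(w <- fset_set [set z | (x <= z <= y)%O]) f x z * (g z w * h w y)).
  apply: eq_big_seq => z; rewrite mem_itv => /andP[xz zy].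
  by rewrite (mulE_widen _ _ xz (lexx y)) big_distrr.
rewrite exchange_big; apply: eq_big_seq => w; rewrite mem_itv => /andP[xw wy].
rewrite (mulE_widen _ _ (lexx x) wy) big_distrl.
by apply: eq_bigr => z _; rewrite mulrA.
Qed.

Lemma inc_mul1 : left_id inc_one inc_mul.
Proof.
move=> f; apply: incP => x y; have [xy|xy] := boolP (x <= y)%O; last first.
  by rewrite !inc_out.
rewrite mulE (bigD1_seq x) ?mem_itv ?lexx ?fset_uniq //=.
rewrite /inc_one_fun eqxx mul1r big1 ?addr0 // => z.
by rewrite eq_sym => /negPf ->; rewrite mul0r.
Qed.

Lemma inc_mulr1 : right_id inc_one inc_mul.
Proof.
move=> f; apply: incP => x y; have [xy|xy] := boolP (x <= y)%O; last first.
  by rewrite !inc_out.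
rewrite mulE (bigD1_seq y) ?mem_itv ?lexx ?xy ?fset_uniq //=.
rewrite /inc_one_fun eqxx mulr1 big1 ?addr0 // => z.
by move=> /negPf ->; rewrite mulr0.
Qed.

Lemma inc_mulDl : left_distributive inc_mul +%R.
Proof.
move=> f g h; apply: incP => x y; rewrite incDE !mulE -big_split.
by apply: eq_bigr => z _; rewrite incDE mulrDl.
Qed.

Lemma inc_mulDr : right_distributive inc_mul +%R.
Proof.
move=> f g h; apply: incP => x y; rewrite incDE !mulE -big_split.
by apply: eq_bigr => z _; rewrite incDE mulrDr.
Qed.

(* Only a [pzRingType]: for empty [X] this is the zero ring. *)
HB.instance Definition _ := GRing.Zmodule_isPzRing.Build incidence
  inc_mulA inc_mul1 inc_mulr1 inc_mulDl inc_mulDr.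

Let incZE t (f : incidence) x y : (t *: f) x y = t *: f x y.
Proof. by []. Qed.

Let incME (f g : incidence) x y : (f * g) x y =
  \sum_(z <- fset_set [set z | (x <= z <= y)%O]) f x z * g z y.
Proof. exact: mulE. Qed.

Lemma inc_scaleAl (t : T) (f g : incidence) : t *: (f * g) = (t *: f) * g.
Proof.
apply: incP => x y; rewrite incZE !incME scaler_sumr.
by apply: eq_bigr => z _; rewrite incZE scalerAl.
Qed.

Lemma inc_scaleAr (t : T) (f g : incidence) : t *: (f * g) = f * (t *: g).
Proof.
apply: incP => x y; rewrite incZE !incME scaler_sumr.
by apply: eq_bigr => z _; rewrite incZE scalerAr.
Qed.

Definition offdiag : set incidence :=
  [set f | forall x y : X, sim x y -> f x y = 0].

Definition idem_fun (x s t : X) : R := ((s == t) && sim x t)%:R.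

Lemma idem_subproof x : idem_fun x \in inc_pred.
Proof.
apply/inc_predP => s t; rewrite /idem_fun; case: eqP => [->|//].
by rewrite lexx.
Qed.

Definition idem (x : X) : incidence := Incidence (idem_subproof x).

Lemma idemM x : idem x * idem x = idem x.
Proof.
apply: incP => s t; have [st|st] := boolP (s <= t)%O; last first.
  by rewrite !inc_out.
rewrite incME (bigD1_seq t) ?mem_itv ?lexx ?st ?fset_uniq //=.
rewrite big1 ?addr0 => [|z /negPf zt]; last first.
  by rewrite /idem_fun zt /= mulr0.
by rewrite /idem_fun eqxx -natrM mulnb -andbA andbb.
Qed.

Definition idem_coset (x : X) : set incidence :=
  [set idem x + m | m in offdiag].

Lemma finite_class (x : X) : finite_set [set z | sim x z].
Proof.
apply: sub_finite_set (finite_interval x x) => z /= /andP[xz zx].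
by rewrite xz zx.
Qed.

Definition class_card (x : X) : nat := #|` fset_set [set z | sim x z]|%fset.

Section Block.
Variable x : X.

Definition block_pred : {pred incidence} :=
  [pred f | `[< exists g, f = idem x * g * idem x >]].

Lemma block_predP f :
  reflect (exists g, f = idem x * g * idem x) (f \in block_pred).
Proof. exact: asboolP. Qed.

Record block := Block {
  block_val :> incidence;
  block_valP : block_val \in block_pred
}.

HB.instance Definition _ := [isSub for block_val].
HB.instance Definition _ := [Choice of block by <:].

Lemma block_pred_submod : submod_closed block_pred.
Proof.
split; first by apply/block_predP; exists 0; rewrite mulr0 mul0r.
move=> t _ _ /block_predP[f ->] /block_predP[g ->]; apply/block_predP.
by exists (t *: f + g); rewrite mulrDr mulrDl -inc_scaleAr -inc_scaleAl.
Qed.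

HB.instance Definition _ := GRing.isSubmodClosed.Build T _ block_pred
  block_pred_submod.
HB.instance Definition _ := [SubChoice_isSubLmodule of block by <:].

Lemma block_one_subproof : idem x \in block_pred.
Proof. by apply/block_predP; exists (idem x); rewrite !idemM. Qed.

Definition block_one : block := Block block_one_subproof.

Lemma block_mul_subproof (a b : block) :
  (a : incidence) * (b : incidence) \in block_pred.
Proof.
have /block_predP[f ->] := block_valP a.
have /block_predP[g ->] := block_valP b.
by apply/block_predP; exists (f * idem x * (idem x * g)); rewrite !mulrA.
Qed.

Definition block_mul a b : block := Block (block_mul_subproof a b).

Lemma block_mulA : associative block_mul.
Proof. by move=> a b c; apply/val_inj; exact: mulrA. Qed.

Lemma block_mul1 : left_id block_one block_mul.
Proof.
move=> a; apply/val_inj => /=; have /block_predP[f ->] := block_valP a.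
by rewrite !mulrA idemM.
Qed.

Lemma block_mulr1 : right_id block_one block_mul.
Proof.
move=> a; apply/val_inj => /=; have /block_predP[f ->] := block_valP a.
by rewrite -!mulrA idemM.
Qed.

Lemma block_mulDl : left_distributive block_mul +%R.
Proof. by move=> a b c; apply/val_inj; exact: mulrDl. Qed.

Lemma block_mulDr : right_distributive block_mul +%R.
Proof. by move=> a b c; apply/val_inj; exact: mulrDr. Qed.

HB.instance Definition _ := GRing.Zmodule_isPzRing.Build block
  block_mulA block_mul1 block_mulr1 block_mulDl block_mulDr.

End Block.
End Incidence.

(* [f] is an isomorphism of [T]-algebras; the actions of [T] are arguments, as
   the library module structure of ['M[R]_n] is over [R] and not over [T]. *)
Definition alg_iso (T : Type) (A B : pzRingType)
    (sA : T -> A -> A) (sB : T -> B -> B) (f : A -> B) : Prop :=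
  [/\ zmod_morphism f, monoid_morphism f,
      forall t a, f (sA t a) = sB t (f a) & bijective f].

Definition inc_iso d' d (T : comNzRingType) (R : algType T)
    (Y : locFinPreorderType d') (X : locFinPreorderType d)
    (phi : incidence Y R -> incidence X R) : Prop :=
  alg_iso (fun (t : T) (f : incidence Y R) => t *: f)
    (fun (t : T) (f : incidence X R) => t *: f) phi.

Definition mx_act (T : comNzRingType) (R : algType T) (n : nat)
    (t : T) (A : 'M[R]_n) : 'M[R]_n :=
  map_mx (fun r : R => t *: r) A.

Definition condition_II d' d (T : comNzRingType) (R : algType T)
    (Y : locFinPreorderType d') (X : locFinPreorderType d) : Prop :=
  forall (phi : incidence Y R -> incidence X R)
         (phi_inv : incidence X R -> incidence Y R),
    inc_iso phi -> cancel phi phi_inv -> cancel phi_inv phi ->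
  forall x : X, exists y : Y, idem_coset y (phi_inv (idem R x)).

(* The blocks of [I(X,R)] are compared with those of [I(Y,R)]. Comparing only
   the blocks of [I(X,R)] with each other would say nothing about [Y]: for [X]
   a point, [Y] two equivalent points and [R] isomorphic to ['M[R]_2], the
   algebras are isomorphic, while [X] and [Y] are not. *)
Definition condition_1 d' d (T : comNzRingType) (R : algType T)
    (Y : locFinPreorderType d') (X : locFinPreorderType d) : Prop :=
  forall (x : X) (y : Y),
    (exists h : block R x -> block R y,
       alg_iso (fun (t : T) (a : block R x) => t *: a)
         (fun (t : T) (b : block R y) => t *: b) h) ->
  class_card x = class_card y.

Definition condition_2 (T : comNzRingType) (R : algType T) : Prop :=
  forall n m : nat, (0 < n)%N -> (0 < m)%N ->
    (exists h : 'M[R]_n -> 'M[R]_m,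
       alg_iso (@mx_act T R n) (@mx_act T R m) h) ->
  n = m.

Definition induces d' d (T : comNzRingType) (R : algType T)
    (Y : locFinPreorderType d') (X : locFinPreorderType d)
    (phi : incidence Y R -> incidence X R) (tau : pquot Y -> pquot X) : Prop :=
  forall (y : Y) (x : X), tau (\pi_(pquot Y) y) = \pi_(pquot X) x ->
    idem_coset x (phi (idem R y)).

Lemma induces_uniq d' d (T : comNzRingType) (R : algType T)
    (Y : locFinPreorderType d') (X : locFinPreorderType d)
    (phi : incidence Y R -> incidence X R) (tau1 tau2 : pquot Y -> pquot X) :
  induces phi tau1 -> induces phi tau2 -> tau1 = tau2.
Proof.
move=> i1 i2; apply/funext => u; elim/quotW: u => y.
have [x1 t1] : exists x, tau1 (\pi y) = \pi_(pquot X) x.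
  by exists (repr (tau1 (\pi y))); rewrite reprK.
have [x2 t2] : exists x, tau2 (\pi y) = \pi_(pquot X) x.
  by exists (repr (tau2 (\pi y))); rewrite reprK.
have [m1 o1 e1] := i1 _ _ t1; have [m2 o2 e2] := i2 _ _ t2.
have : idem R x1 x1 x1 + m1 x1 x1 = idem R x2 x1 x1 + m2 x1 x1.
  by rewrite -(incDE (idem R x1)) -(incDE (idem R x2)) e1 e2.
rewrite o1 ?o2 ?sim_refl // !addr0 /= /idem_fun eqxx sim_refl t1 t2 /=.
case: (boolP (sim x2 x1)) => [s21 _|_ /eqP]; last by rewrite oner_eq0.
by apply/eqmodP; rewrite /= sim_sym.
Qed.

Definition lifts d' d (Y : preorderType d') (X : preorderType d)
    (tau : Y -> X) (taubar : pquot Y -> pquot X) : Prop :=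
  forall y : Y, taubar (\pi_(pquot Y) y) = \pi_(pquot X) (tau y).

(* Main.v *)
Require Import Defs.
From mathcomp Require Import all_boot all_order all_algebra.
From mathcomp Require Import finmap generic_quotient.
From mathcomp Require Import boolp classical_sets functions cardinality fsbigop.

(* Write e_x, f_y for the diagonal idempotents of K and K'. Since intervals are
   finite, M contains no nonzero idempotent; since moreover e_x M e_x = 0, an
   idempotent a in e_x + M satisfies a e_x a = a and e_x a e_x = e_x. Condition
   (II) thus gives phi^-1(e_x) f_y phi^-1(e_x) = phi^-1(e_x) and
   f_y phi^-1(e_x) f_y = f_y for a suitable y = s(x). These relations are
   preserved by phi, which yields phi(f_y) in e_x + M because e_x is central
   modulo M, and they identify corners: x <= x' means e_x K e_x' <> 0, so s
   preserves and reflects the order, and R_x is isomorphic to R_{s(x)}. For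
   surjectivity, phi(f_y) is not in M, so e_x phi(f_y) e_x <> 0 for some x, and
   this forces s(x) ~ y. Finally R_x = M(n_x, R), so under either condition
   corresponding classes have the same size, and bijections between them lift the
   isomorphism of quotients. *)

Set Implicit Arguments.
Unset Strict Implicit.
Unset Printing Implicit Defensive.

Import Order.TTheory GRing.Theory.

Local Open Scope classical_set_scope.
Local Open Scope quotient_scope.
Local Open Scope ring_scope.

(** * Inverses and composites of algebra isomorphisms *)

Section AlgebraIsomorphisms.
Context {T : Type} {A B C : pzRingType}.
Variables (sA : T -> A -> A) (sB : T -> B -> B) (sC : T -> C -> C).

Lemma alg_iso_inv (f : A -> B) (g : B -> A) :
  alg_iso sA sB f -> cancel f g -> cancel g f -> alg_iso sB sA g.
Proof.
move=> [fB [f1 fM] fZ _] fK gK; split; last by exists f.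
- by move=> x y; apply: (can_inj fK); rewrite fB !gK.
- split; first by apply: (can_inj fK); rewrite gK f1.
  by move=> x y; apply: (can_inj fK); rewrite fM !gK.
- by move=> t a; apply: (can_inj fK); rewrite fZ !gK.
Qed.

Lemma alg_iso_comp (f : A -> B) (g : B -> C) :
  alg_iso sA sB f -> alg_iso sB sC g -> alg_iso sA sC (g \o f).
Proof.
move=> [fB [f1 fM] fZ fbij] [gB [g1 gM] gZ gbij]; split=> /=.
- by move=> x y /=; rewrite fB gB.
- by split=> [|x y] /=; rewrite ?f1 // fM gM.
- by move=> t a; rewrite fZ gZ.
- exact: bij_comp.
Qed.

Lemma alg_iso0 (f : A -> B) : alg_iso sA sB f -> f 0 = 0.
Proof. by case=> fB _ _ _; rewrite -(subrr 0) fB !subrr. Qed.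

End AlgebraIsomorphisms.

(** * Mutually inner inverse elements and the corners they cut out *)

Section InnerInverses.
Context {A : pzRingType}.

(* For idempotents [a] and [b], the compressions [k |-> b k b] and
   [k |-> a k a] are then inverse isomorphisms between [a A a] and [b A b]. *)
Definition inner_inverses (a b : A) : Prop := a * b * a = a /\ b * a * b = b.

Lemma inner_inversesC a b : inner_inverses a b -> inner_inverses b a.
Proof. by case. Qed.

(** Multiplying by [a] and [a'] undoes the multiplication by [b] and [b']. *)
Lemma inner_inverses_corner a b a' b' (k : A) :
  inner_inverses a b -> inner_inverses a' b' ->
  a * k * a' != 0 -> b * (a * k * a') * b' != 0.
Proof.
move=> [aba _] [a'b'a' _]; apply: contra_neq => z.
have -> : a * k * a' = a * (b * (a * k * a') * b') * a'.
  rewrite !mulrA aba -(mulrA _ b' a') -(mulrA _ a') (mulrA a' b').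
  by rewrite a'b'a'.
by rewrite z mulr0 mul0r.
Qed.

(** Since [k] absorbs [a] on the right and [k'] on the left, [a f a = a] gives [k k' = k f k']. *)
Lemma compressionM (a f k k' : A) : a * f * a = a -> f * f = f ->
  k * a = k -> a * k' = k' -> f * (k * k') * f = f * k * f * (f * k' * f).
Proof.
move=> afa ff ka ak'.
have -> : k * k' = k * f * k'.
  by rewrite -{2}ka -{2}ak' !mulrA -(mulrA k a f) -(mulrA k _ a) afa ka.
by rewrite !mulrA -(mulrA _ f f) ff.
Qed.

Lemma compressionK (a f k : A) : a * f * a = a ->
  a * k = k -> k * a = k -> a * (f * k * f) * a = k.
Proof.
move=> afa ak ka; rewrite -{1}ak -{1}ka !mulrA afa ak.
by rewrite -(mulrA k a f) -(mulrA k _ a) afa ka.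
Qed.

End InnerInverses.

(** * Entries of products, congruence modulo [offdiag], idempotents *)

Section Products.
Context {d : Order.disp_t} {T : comNzRingType}.
Context {X : locFinPreorderType d} {R : algType T}.
Implicit Types (f g a : incidence X R) (x y s t : X).

Lemma incME f g s t : (f * g) s t =
  \sum_(z <- fset_set [set z | (s <= z <= t)%O]) f s z * g z t.
Proof.
by rewrite [LHS]/= /inc_mul_fun fsbig_finite //; exact: finite_interval.
Qed.

Lemma incBE f g s t : (f - g) s t = f s t - g s t.
Proof. by []. Qed.

Lemma in_interval s t z :
  (z \in fset_set [set z | (s <= z <= t)%O]) = (s <= z <= t)%O.
Proof.
by rewrite in_fset_set ?inE //; [apply/idP/idP; rewrite inE | exact: finite_interval].
Qed.

Lemma idem_mulE x f s t : (idem R x * f) s t = if sim x s then f s t else 0.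
Proof.
have [st|st] := boolP (s <= t)%O; last by rewrite !inc_out // if_same.
rewrite incME (bigD1_seq s) ?in_interval ?lexx ?st ?fset_uniq //=.
rewrite big1 ?addr0 /idem_fun ?eqxx /= => [|z /negPf zs].
  by case: sim; rewrite (mul1r, mul0r).
by rewrite eq_sym zs mul0r.
Qed.

Lemma mul_idemE x f s t : (f * idem R x) s t = if sim x t then f s t else 0.
Proof.
have [st|st] := boolP (s <= t)%O; last by rewrite !inc_out // if_same.
rewrite incME (bigD1_seq t) ?in_interval ?lexx ?st ?fset_uniq //=.
rewrite big1 ?addr0 /idem_fun ?eqxx /= => [|z /negPf zt].
  by case: sim; rewrite (mulr1, mulr0).
by rewrite zt mulr0.
Qed.

Lemma idem_cornerE x y f s t :
  (idem R x * f * idem R y) s t = if sim x s && sim y t then f s t else 0.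
Proof. by rewrite mul_idemE idem_mulE; do 2!case: sim. Qed.

(** Congruence modulo the ideal M, expressed entrywise instead of through a quotient ring. *)
Definition eq_diag f g := forall s t, sim s t -> f s t = g s t.

Lemma eq_diag_refl f : eq_diag f f.
Proof. by []. Qed.

Lemma eq_diag_sym f g : eq_diag f g -> eq_diag g f.
Proof. by move=> fg s t /fg. Qed.

Lemma eq_diag_trans f g h : eq_diag f g -> eq_diag g h -> eq_diag f h.
Proof. by move=> fg gh s t st; rewrite fg // gh. Qed.

(** When [s ~ t], every point between them lies in their class, so the product involves only entries
    of the factors within that class. *)
Lemma eq_diagM f f' g g' :
  eq_diag f f' -> eq_diag g g' -> eq_diag (f * g) (f' * g').
Proof.
move=> ff' gg' s t /andP[st ts]; rewrite !incME; apply: eq_big_seq => z.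
rewrite in_interval => /andP[sz zt].
rewrite ff' ?gg' // /sim ?sz ?zt /=.
  exact: le_trans ts sz.
exact: le_trans zt ts.
Qed.

Lemma idem_cosetE x f : idem_coset x f <-> eq_diag f (idem R x).
Proof.
split=> [[m m0 <-] s t st|fx]; first by rewrite incDE m0 // addr0.
exists (f - idem R x); last by rewrite addrC subrK.
by move=> s t st; rewrite incBE fx // subrr.
Qed.

Lemma sim_eq x y s : sim x y -> sim x s = sim y s.
Proof.
move=> xy; apply/idP/idP; first by apply: sim_trans; rewrite sim_sym.
exact: sim_trans.
Qed.

Lemma idem_sim x y : sim x y -> idem R x = idem R y.
Proof.
by move=> xy; apply: incP => s t; rewrite /= /idem_fun (sim_eq _ xy).
Qed.

Lemma idem_central_diag x f : eq_diag (idem R x * f) (f * idem R x).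
Proof.
move=> s t st; rewrite idem_mulE mul_idemE.
by rewrite (sim_sym x s) (sim_sym x t) (sim_eq _ st).
Qed.

Lemma eq_diag0_idem_corner x f : eq_diag f 0 -> idem R x * f * idem R x = 0.
Proof.
move=> f0; apply: incP => s t; rewrite idem_cornerE.
case: ifP => // /andP[xs xt]; rewrite f0 //.
by apply: sim_trans xt; rewrite sim_sym.
Qed.

Lemma idem_corner_sim x y f :
  (forall s t, sim x s -> sim y t -> f s t = 0) -> idem R x * f * idem R y = 0.
Proof.
by move=> f0; apply: incP => s t; rewrite idem_cornerE; case: ifP => // /andP[/f0 h /h].
Qed.

(* Expand [a = a * a] along the interval [[s, t]]: in each term either the
   second factor is on the diagonal or the first has a smaller interval. *)
Lemma idempotent_diag0 a : a * a = a -> eq_diag a 0 -> a = 0.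
Proof.
move=> aa a0; apply: incP => s t.
have [n] := ubnP #|` fset_set [set z | (s <= z <= t)%O]|%fset.
elim: n t => // n IH t; rewrite ltnS => size_st.
rewrite -aa incME big_seq big1 // => z; rewrite in_interval => /andP[sz zt].
have [tz|tz] := boolP (t <= z)%O; first by rewrite (a0 z t) ?mulr0 // /sim zt.
rewrite IH ?mul0r //; apply: leq_trans size_st; apply: fproper_ltn_card.
rewrite fproperEneq; apply/andP; split; last first.
  apply/fsubsetP => w; rewrite !in_interval => /andP[-> wz]; exact: le_trans wz zt.
apply/eqP => /fsetP /(_ t).
by rewrite !in_interval lexx (le_trans sz zt) (negPf tz) andbF.
Qed.

(** This expresses the order through products with the idempotents, a form that can be carried along
    an isomorphism. *)
Lemma idem_leP x y :
  reflect (exists k, idem R x * k * idem R y != 0) (x <= y)%O.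
Proof.
apply: (iffP idP) => [xy|[k k0]].
  (* The witness is the zeta function of [X]. *)
  have zP : (fun s t : X => (s <= t)%O%:R : R) \in @inc_pred d T X R.
    by apply/inc_predP => s t /negPf ->.
  exists (Incidence zP); apply/eqP => /(congr1 (fun f => inc_fun f x y)).
  by rewrite idem_cornerE !sim_refl /= xy => /eqP; rewrite oner_eq0.
apply: contraNT k0 => xy; apply/eqP/idem_corner_sim => s t /andP[xs _] /andP[_ ty].
rewrite inc_out //; apply: contra xy => st.
exact: le_trans xs (le_trans st ty).
Qed.

Lemma idem_neq0 x : idem R x != 0.
Proof.
apply/eqP => /(congr1 (fun f => inc_fun f x x)).
by rewrite /= /idem_fun eqxx sim_refl => /eqP; rewrite oner_eq0.
Qed.

(** The relation [e a e = e] is read off entrywise; the other holds because [a - a e a] is an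
    idempotent in [offdiag], hence zero. *)
Lemma inner_inverses_idem x a :
  a * a = a -> eq_diag a (idem R x) -> inner_inverses a (idem R x).
Proof.
set e := idem R x => aa ae.
have eae : e * a * e = e.
  apply: incP => s t; rewrite idem_cornerE; case: ifP => [/andP[xs xt]|st].
    by rewrite ae //; apply: sim_trans xt; rewrite sim_sym.
  by rewrite /e /= /idem_fun; case: eqP => //= st'; move: st; rewrite st' andbb => ->.
split=> //; apply/eqP; rewrite eq_sym -subr_eq0; apply/eqP/idempotent_diag0.
  set b := a * e * a.
  have ab : a * b = b by rewrite /b !mulrA aa.
  have ba : b * a = b by rewrite /b -!mulrA aa.
  have bb : b * b = b.
    by rewrite {1}/b -(mulrA _ a) ab /b !mulrA -(mulrA a e a) -(mulrA a _ e) eae mulrA.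
  by rewrite mulrBr !mulrBl aa ab ba bb subrr subr0.
have aea : eq_diag (a * e * a) e.
  by have := eq_diagM (eq_diagM ae (eq_diag_refl e)) ae; rewrite !idemM.
by move=> s t st; rewrite incBE aea // ae // subrr.
Qed.

(* The diagonal part of [idem x] is central modulo [offdiag], so that both
   [g = g e g] and [e = e g e] reduce to [e g] there. *)
Lemma inner_inverses_diag x g :
  g * g = g -> inner_inverses g (idem R x) -> eq_diag g (idem R x).
Proof.
set e := idem R x => gg [geg ege].
have c f : eq_diag (e * f) (f * e) by exact: idem_central_diag.
apply: (@eq_diag_trans _ (e * g)).
  rewrite -[X in eq_diag X _]geg -[X in eq_diag _ (_ * X)]gg mulrA.
  by apply: eq_diagM => //; apply: eq_diag_sym.
rewrite -[X in eq_diag _ X]ege -[X in eq_diag (X * _)]idemM -mulrA.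
by rewrite -[X in eq_diag _ X]mulrA; apply: eq_diagM.
Qed.

(* If [x] and [y] are not equivalent, [a * idem y * a] is in [offdiag], which
   meets the corner of [a] trivially, as it does that of [idem x]. *)
Lemma idem_corner_diag x y a :
  a * a = a -> eq_diag a (idem R x) -> a * idem R y * a != 0 -> sim x y.
Proof.
move=> aa ax; have [aea eae] := inner_inverses_idem aa ax.
apply: contraNT => xy.
have d0 : eq_diag (a * idem R y * a) 0.
  apply: (@eq_diag_trans _ (idem R x * idem R y * idem R x)).
    by apply: (eq_diagM (eq_diagM ax (eq_diag_refl _)) ax).
  move=> s t _; rewrite idem_cornerE; case: ifP => // /andP[_ xt].
  rewrite /= /idem_fun; case: (boolP (sim y t)) => [yt|]; last by rewrite andbF.
  by case/negP: xy; apply: (sim_trans xt); rewrite sim_sym.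
apply/eqP; have := eq_diag0_idem_corner x d0.
move/(congr1 (fun f => a * f * a)); rewrite !mulrA aea mulr0 mul0r.
by rewrite -(mulrA _ _ a) -(mulrA _ a) (mulrA a) aea.
Qed.

(** If all these corners vanished, [a] would be an idempotent in [offdiag]. *)
Lemma idempotent_corner_neq0 a :
  a * a = a -> a != 0 -> exists x, idem R x * a * idem R x != 0.
Proof.
move=> aa; apply: contraNP => /forallNP h; apply/eqP/idempotent_diag0 => // s t st.
have /negP/negPn/eqP/(congr1 (fun f => inc_fun f s t)) := h s.
by rewrite idem_cornerE sim_refl st.
Qed.

End Products.

(** * Enumeration of an equivalence class *)

Section ClassEnumeration.
Context {d : Order.disp_t} {X : locFinPreorderType d}.
Implicit Types (x s t z : X).

Lemma in_class x z : (z \in fset_set [set z | sim x z]) = sim x z.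
Proof.
by rewrite in_fset_set ?inE //; [apply/idP/idP; rewrite inE | exact: finite_class].
Qed.

Lemma class_enum x n : class_card x = n ->
  exists (ev : 'I_n -> X) (rk : X -> 'I_n),
    [/\ cancel ev rk, forall i, sim x (ev i) &
        forall z, sim x z -> ev (rk z) = z].
Proof.
move=> <-; set E := enum_fset (fset_set [set z | sim x z]).
have sE : class_card x = size E by [].
have memE z : (z \in E) = sim x z by exact: in_class.
have idx z : sim x z -> (index z E < class_card x)%N.
  by rewrite sE index_mem memE.
(* [i0] serves as the rank of points outside the class. *)
have i0 : 'I_(class_card x) := Ordinal (idx x (sim_refl x)).
exists (fun i => nth x E i), (fun z => insubd i0 (index z E)); split.
- move=> i; apply: val_inj; rewrite val_insubd index_uniq ?fset_uniq //.
  by rewrite ltn_ord.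
- by move=> i; rewrite -memE mem_nth.
- by move=> z xz; rewrite val_insubd idx // nth_index // memE.
Qed.

Lemma class_card_gt0 x : (0 < class_card x)%N.
Proof.
have [_ [rk _]] := class_enum (erefl (class_card x)).
exact: leq_ltn_trans (leq0n _) (ltn_ord (rk x)).
Qed.

End ClassEnumeration.

(** * Passing between preordered sets and their quotients *)

Section Lifting.
Context {d' d : Order.disp_t}.
Context {Y : locFinPreorderType d'} {X : locFinPreorderType d}.

Lemma eq_pi (e : Order.disp_t) (Z : preorderType e) (x y : Z) :
  \pi_(pquot Z) x = \pi_(pquot Z) y <-> sim x y.
Proof. by split=> [/eqmodP|xy]; last apply/eqmodP. Qed.

Lemma class_bijection (y : Y) (x : X) : class_card x = class_card y ->
  exists (f : Y -> X) (g : X -> Y),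
    (forall t, sim y t -> sim x (f t) /\ g (f t) = t) /\
    (forall s, sim x s -> sim y (g s) /\ f (g s) = s).
Proof.
move=> /class_enum[evx [rkx [evxK evx_sim rkxK]]].
have [evy [rky [evyK evy_sim rkyK]]] := class_enum (erefl (class_card y)).
exists (evx \o rky), (evy \o rkx); split=> z yz /=.
  by rewrite evxK rkyK.
by rewrite evyK rkxK.
Qed.

Lemma lift_order_iso (taubar : pquot Y -> pquot X) :
  order_iso taubar ->
  (forall y x, taubar (\pi y) = \pi x -> class_card x = class_card y) ->
  exists tau : Y -> X, order_iso tau /\ lifts tau taubar.
Proof.
move=> [[sigma tauK sigmaK] mono_tau] card_tau.
(* The choice is indexed by classes, so that equivalent points are moved by the same bijection. *)
have /choice[F] : forall u : pquot Y, exists fg : (Y -> X) * (X -> Y),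
    (forall t, sim (repr u) t ->
       sim (repr (taubar u)) (fg.1 t) /\ fg.2 (fg.1 t) = t) /\
    (forall s, sim (repr (taubar u)) s ->
       sim (repr u) (fg.2 s) /\ fg.1 (fg.2 s) = s).
  move=> u; have [|f [g fg]] := @class_bijection (repr u) (repr (taubar u)).
    by apply: card_tau; rewrite !reprK.
  by exists (f, g).
move=> FP.
pose tau y := (F (\pi y)).1 y; pose tau' x := (F (sigma (\pi x))).2 x.
have pi_tau y : \pi_(pquot X) (tau y) = taubar (\pi y).
  have [/(_ y (sim_repr y))[+ _] _] := FP (\pi y).
  by move=> /eq_pi; rewrite reprK.
have pi_tau' x : \pi_(pquot Y) (tau' x) = sigma (\pi x).
  have [_] := FP (sigma (\pi x)); rewrite sigmaK => /(_ x (sim_repr x))[+ _].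
  by move=> /eq_pi; rewrite reprK.
exists tau; split; last by move=> y; rewrite pi_tau.
(* The order depends only on classes, where [taubar] controls it. *)
split; last by move=> y z; rewrite -pi_le -[RHS]pi_le !pi_tau mono_tau.
exists tau' => z.
  rewrite /tau' pi_tau tauK /tau.
  by have [/(_ z (sim_repr z))[]] := FP (\pi z).
rewrite /tau pi_tau' /tau'.
by have [_] := FP (sigma (\pi z)); rewrite sigmaK => /(_ z (sim_repr z))[].
Qed.

(** A map bijective only on classes may have no inverse on points; a choice [t] of preimages up to
    equivalence inverts it on the quotients. *)
Lemma quotient_order_iso (s : X -> Y) :
  {mono s : x z / (x <= z)%O} -> (forall y, exists x, sim (s x) y) ->
  exists taubar : pquot Y -> pquot X, order_iso taubar /\
    forall y x, taubar (\pi y) = \pi x -> sim (s x) y.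
Proof.
move=> mono_s /choice[t st].
have mono_t : {mono t : y z / (y <= z)%O}.
  move=> y z; rewrite -mono_s.
  have /andP[sy ys] := st y; have /andP[sz zs] := st z.
  apply/idP/idP => h; first exact: le_trans ys (le_trans h sz).
  exact: le_trans sy (le_trans h zs).
have sim_s x z : sim (s x) (s z) = sim x z by rewrite /sim !mono_s.
exists (fun u => \pi_(pquot X) (t (repr u))); split=> [|y x /eq_pi].
  split; last by move=> u v; rewrite pi_le mono_t.
  exists (fun v => \pi_(pquot Y) (s (repr v))) => u.
    rewrite -[RHS]reprK; apply/eq_pi; apply: sim_trans (st _).
    by rewrite sim_s; exact: sim_repr.
  rewrite -[RHS]reprK; apply/eq_pi; rewrite -sim_s.
  by apply: sim_trans (st _) _; exact: sim_repr.
rewrite -sim_s sim_sym => /sim_trans; apply.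
by apply: sim_trans (st _) _; exact: sim_repr.
Qed.

End Lifting.

(** * Elements of the corner of an idempotent [e_x] *)

Section Corners.
Context {d : Order.disp_t} {T : comNzRingType} {R : algType T}.
Context {X : locFinPreorderType d}.

Lemma block_idl x (b : block R x) : idem R x * (b : incidence X R) = b.
Proof. by have /block_predP[g ->] := block_valP b; rewrite !mulrA idemM. Qed.

Lemma block_idr x (b : block R x) : (b : incidence X R) * idem R x = b.
Proof. by have /block_predP[g ->] := block_valP b; rewrite -!mulrA idemM. Qed.

Lemma in_block x (f : incidence X R) :
  idem R x * f * idem R x \in block_pred x.
Proof. by apply/block_predP; exists f. Qed.

End Corners.

(** * Isomorphism of corresponding corners *)

Section BlockIso.
Context {d' d : Order.disp_t} {T : comNzRingType} {R : algType T}.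
Context {Y : locFinPreorderType d'} {X : locFinPreorderType d}.
Variables (phi : incidence Y R -> incidence X R).
Variables (psi : incidence X R -> incidence Y R).
Hypotheses (phi_iso : inc_iso phi) (phiK : cancel phi psi) (psiK : cancel psi phi).

(** The map is [psi] followed by compression with [f]; its inverse is [phi] followed by compression
    with [e]. *)
Lemma block_alg_iso x y : inner_inverses (psi (idem R x)) (idem R y) ->
  exists h : block R x -> block R y,
    alg_iso (fun (t : T) (a : block R x) => t *: a)
            (fun (t : T) (b : block R y) => t *: b) h.
Proof.
set f := idem R y; set e := idem R x; move=> [afa faf].
have [phiB [_ phiM] _ _] := phi_iso.
have [psiB [_ psiM] psiZ _] := alg_iso_inv phi_iso phiK psiK.
have ege : e * phi f * e = e.
  by apply: (can_inj psiK); rewrite !psiM phiK.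
pose h (b : block R x) := Block (in_block y (psi b)).
pose h' (c : block R y) := Block (in_block x (phi c)).
exists h; split.
- by move=> b c; apply: val_inj; rewrite /= psiB mulrBr mulrBl.
- split; first exact: val_inj.
  move=> b c; apply: val_inj; rewrite /= psiM.
  apply: compressionM afa (idemM _ _) _ _.
    by rewrite -psiM block_idr.
  by rewrite -psiM block_idl.
- by move=> t b; apply: val_inj; rewrite /= psiZ -inc_scaleAr -inc_scaleAl.
- exists h' => b; apply: val_inj => /=.
    rewrite !phiM psiK -/f; apply: compressionK ege _ _; first exact: block_idl.
    exact: block_idr.
  rewrite !psiM phiK; apply: compressionK faf _ _; first exact: block_idl.
  exact: block_idr.
Qed.

End BlockIso.

(** * Corners as full matrix algebras *)

Section BlockMatrices.
Context {d : Order.disp_t} {T : comNzRingType} {R : algType T}.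
Context {X : locFinPreorderType d}.

Lemma block_mx_alg_iso (x : X) n : class_card x = n ->
  exists h : block R x -> 'M[R]_n,
    alg_iso (fun (t : T) (a : block R x) => t *: a) (@mx_act T R n) h.
Proof.
move=> /class_enum[ev [rk [evK ev_sim rkK]]].
(* The interval between two points of a class is the whole class, so convolution becomes the matrix
   product. *)
have sum_class (F : X -> R) s t : sim x s -> sim x t ->
    \sum_(z <- fset_set [set z | (s <= z <= t)%O]) F z = \sum_(i < n) F (ev i).
  move=> xs xt; have -> : \sum_(i < n) F (ev i) =
      \sum_(z <- [seq ev i | i <- enum 'I_n]) F z by rewrite big_map big_enum.
  apply: perm_big; apply: uniq_perm; rewrite ?fset_uniq //.
    by rewrite map_inj_uniq ?enum_uniq //; exact: can_inj evK.
  move=> z; rewrite in_interval; apply/idP/mapP => [/andP[sz zt]|[i _ ->]].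
    exists (rk z); rewrite ?mem_enum // rkK // /sim.
    move: xs xt => /andP[xs _] /andP[_ tx].
    by rewrite (le_trans xs sz) (le_trans zt tx).
  move: xs xt (ev_sim i) => /andP[_ sx] /andP[xt _] /andP[xi ix].
  by rewrite (le_trans sx xi) (le_trans ix xt).
pose h (b : block R x) : 'M[R]_n := \matrix_(i, j) (b : incidence X R) (ev i) (ev j).
(* Extension by zero outside the class, where [rk] takes arbitrary values. *)
pose g_fun (A : 'M[R]_n) s t := if sim x s && sim x t then A (rk s) (rk t) else 0.
have gP A : g_fun A \in @inc_pred d T X R.
  apply/inc_predP => s t; rewrite /g_fun; case: ifP => // /andP[/andP[_ sx] /andP[xt _]].
  by rewrite (le_trans sx xt).
pose g A : block R x := Block (in_block x (Incidence (gP A))).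
exists h; split.
- by move=> b c; apply/matrixP => i j; rewrite !mxE.
- split.
    apply/matrixP => i j; rewrite !mxE /= /idem_fun ev_sim andbT.
    by rewrite (can_eq evK).
  move=> b c; apply/matrixP => i j; rewrite !mxE.
  rewrite [LHS]incME sum_class //.
  by apply: eq_bigr => k _; rewrite !mxE.
- by move=> t b; apply/matrixP => i j; rewrite !mxE.
- exists g => [b|A].
    apply: val_inj; apply: incP => s t; rewrite [LHS]idem_cornerE /= /g_fun.
    rewrite -[in RHS](block_idl b) -[in RHS](block_idr b) mulrA idem_cornerE.
    by case: ifP => // /andP[xs xt]; rewrite mxE !rkK ?xs ?xt.
  apply/matrixP => i j; rewrite mxE [LHS]idem_cornerE /= /g_fun.
  by rewrite !ev_sim /= !evK.
Qed.

End BlockMatrices.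

(** The identification of blocks with matrix algebras turns an isomorphism of blocks into one of
    matrix algebras, of positive sizes as classes are nonempty. *)
Lemma condition_2_1 (d' d : Order.disp_t) (T : comNzRingType) (R : algType T)
    (Y : locFinPreorderType d') (X : locFinPreorderType d) :
  condition_2 R -> condition_1 R Y X.
Proof.
move=> c2 x y [h h_iso]; apply: c2 (class_card_gt0 x) (class_card_gt0 y) _.
have [mx mx_iso] := block_mx_alg_iso (R := R) (erefl (class_card x)).
have [my my_iso] := block_mx_alg_iso (R := R) (erefl (class_card y)).
have [_ _ _ [mx' mxK mxK']] := mx_iso.
exists (my \o (h \o mx')).
by apply: alg_iso_comp my_iso; apply: alg_iso_comp h_iso; exact: alg_iso_inv mx_iso mxK mxK'.
Qed.

(** * The map of indices [s] supplied by Condition (II) *)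

Section Main.
Context {d' d : Order.disp_t} {T : comNzRingType} {R : algType T}.
Context {Y : locFinPreorderType d'} {X : locFinPreorderType d}.
Variables (phi : incidence Y R -> incidence X R).
Variables (psi : incidence X R -> incidence Y R).
Hypotheses (phi_iso : inc_iso phi) (phiK : cancel phi psi) (psiK : cancel psi phi).
Variable s : X -> Y.
Hypothesis psi_idem : forall x, idem_coset (s x) (psi (idem R x)).

Let phiM : {morph phi : f g / f * g}.
Proof. by have [_ []] := phi_iso. Qed.

Let psiM : {morph psi : f g / f * g}.
Proof. by have [_ []] := alg_iso_inv phi_iso phiK psiK. Qed.

Let psi_idemM x : psi (idem R x) * psi (idem R x) = psi (idem R x).
Proof. by rewrite -psiM idemM. Qed.

Let psi_diag x : eq_diag (psi (idem R x)) (idem R (s x)).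
Proof. exact/idem_cosetE. Qed.

Lemma inner_inverses_psi x y : sim (s x) y ->
  inner_inverses (psi (idem R x)) (idem R y).
Proof. by move=> /(@idem_sim _ T _ R) <-; exact: inner_inverses_idem. Qed.

(** Applying [phi] to the inner inverse relations links [phi f_y] with [e_x] itself. *)
Lemma idem_coset_phi x y : sim (s x) y -> idem_coset x (phi (idem R y)).
Proof.
move=> /inner_inverses_psi[eye yey]; apply/idem_cosetE/inner_inverses_diag.
  by rewrite -phiM idemM.
by split; apply: (can_inj psiK); rewrite !psiM phiK.
Qed.

(** Nonvanishing of corners encodes the order on both sides; it survives [psi] and the exchange of
    [psi e_x] with its inner inverse. *)
Lemma index_mono : {mono s : x z / (x <= z)%O}.
Proof.
have psi0 : psi 0 = 0 by exact: alg_iso0 (alg_iso_inv phi_iso phiK psiK).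
move=> x z; have ix := inner_inverses_psi (sim_refl (s x)).
have iz := inner_inverses_psi (sim_refl (s z)).
apply/(idem_leP (R := R))/(idem_leP (R := R)) => -[k k0].
  have := inner_inverses_corner (inner_inversesC ix) (inner_inversesC iz) k0.
  set k' := (X in _ * X * _) => k'0; exists (phi k').
  by apply: contra_neq k'0 => /(congr1 psi); rewrite !psiM phiK psi0.
exists (psi (idem R x * k * idem R z)); rewrite !psiM.
apply: inner_inverses_corner ix iz _; apply: contra_neq k0 => z0.
by apply: (can_inj psiK); rewrite !psiM psi0.
Qed.

(** The nonzero idempotent [phi f_y] has a nonzero corner at some [e_x]; pulled back by [psi], it
    forces the class of [s x] to be that of [y]. *)
Lemma index_surj y : exists x, sim (s x) y.
Proof.
have psi0 : psi 0 = 0 by exact: alg_iso0 (alg_iso_inv phi_iso phiK psiK).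
have [||x xy] := @idempotent_corner_neq0 _ _ _ _ (phi (idem R y)).
- by rewrite -phiM idemM.
- by apply: contra_neq (idem_neq0 (R := R) y) => /(congr1 psi); rewrite phiK psi0.
exists x; apply: idem_corner_diag (psi_idemM x) (psi_diag x) _.
apply: contra_neq xy => /(congr1 phi); rewrite !phiM psiK => ->.
by apply: (can_inj psiK); rewrite phiK psi0.
Qed.

End Main.

Theorem theorem13p1 (T : comNzRingType) (R : algType T) (d' d : Order.disp_t)
    (Y : locFinPreorderType d') (X : locFinPreorderType d) :
  condition_II R Y X ->
  (forall phi : incidence Y R -> incidence X R, inc_iso phi ->
     exists taubar : pquot Y -> pquot X,
       order_iso taubar /\ induces phi taubar) /\
  (condition_1 R Y X \/ condition_2 R ->
   forall phi : incidence Y R -> incidence X R, inc_iso phi ->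
     exists taubar : pquot Y -> pquot X,
       [/\ order_iso taubar, induces phi taubar &
           exists tau : Y -> X, order_iso tau /\ lifts tau taubar]).
Proof.
move=> cII.
(* One construction serves both parts; the isomorphisms of blocks are recorded for use with
   Condition (1). *)
have quotient_iso (phi : incidence Y R -> incidence X R) : inc_iso phi ->
    exists taubar : pquot Y -> pquot X,
      [/\ order_iso taubar, induces phi taubar &
          forall y x, taubar (\pi y) = \pi x ->
            exists h : block R x -> block R y,
              alg_iso (fun (t : T) (a : block R x) => t *: a)
                      (fun (t : T) (b : block R y) => t *: b) h].
  move=> phi_iso; have [_ _ _ [psi phiK psiK]] := phi_iso.
  (* The index map [s] runs from [X] to [Y], opposite to [taubar]. *)
  have /choice[s sP] := cII phi psi phi_iso phiK psiK.
  have [taubar [tau_iso tauP]] := quotient_order_iso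
    (index_mono phi_iso phiK psiK sP) (index_surj phi_iso phiK psiK sP).
  exists taubar; split=> [|y x /tauP|y x /tauP sy] //.
    exact: idem_coset_phi.
  apply: (block_alg_iso phi_iso phiK psiK).
  exact: (inner_inverses_psi phi_iso phiK psiK sP sy).
split=> [phi /quotient_iso[taubar [? ? _]]|c phi /quotient_iso[taubar [? ? blocks]]].
  by exists taubar.
have c1 : condition_1 R Y X by case: c => // /condition_2_1; apply.
by exists taubar; split=> //; apply: lift_order_iso => // y x /blocks; exact: c1.
Qed.
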